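(* Let $(\alpha_N)_{N\ge1}$ be positive numbers with $\sum_N 3^N\alpha_N<\infty$. Then for Lebesgue almost every $\lambda\in[\tfrac12,\,0.668]$, $$g_N(\lambda)>\alpha_N\quad\text{for infinitely many } N.$$
   Context: For $\lambda\in(0,1)$ and $N\ge 1$, let $A'_N(\lambda)=\{\sum_{n=0}^{N-1}a_n\lambda^n:\ a_n\in\{0,1\}\}$, taken with multiplicity (one point for each of the $2^N$ sequences $(a_0,\dots,a_{N-1})\in\{0,1\}^N$). The smallest gap is $g_N(\lambda)=\min\{|\sum_{n=0}^{N-1}(a_n-b_n)\lambda^n| : (a_n),(b_n)\in\{0,1\}^N,\ (a_n)\neq(b_n)\}$, i.e. the smallest spacing between consecutive points of the ordered sequence $A'_N(\lambda)$ counted with multiplicity. *)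

(* Defs.v *)
From HB Require Import structures.
From mathcomp Require Export all_boot all_order all_algebra.
From mathcomp Require Export all_classical all_reals all_analysis.
Set Implicit Arguments.
Unset Strict Implicit.
Unset Printing Implicit Defensive.
Import Order.TTheory GRing.Theory Num.Theory.

Local Open Scope classical_set_scope.
Local Open Scope ring_scope.

Definition digit_diff (R : realType) (N : nat) (a b : {ffun 'I_N -> bool})
    (lambda : R) : R :=
  \sum_(n < N) ((a n)%:R - (b n)%:R) * lambda ^+ n.

(* Distinct digit sequences, possibly with equal sums, so that points of
   A'_N(lambda) are counted with multiplicity. *)
Definition gaps (R : realType) (N : nat) (lambda : R) : set R :=
  [set g : R | exists a b : {ffun 'I_N -> bool},
     a != b /\ g = `|digit_diff a b lambda| ].

(* For 0 < N the infimum is over a finite nonempty set, hence a minimum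
   (lemmas gap_mem and gap_le); for N = 0 the set is empty and the value
   is irrelevant. *)
Definition gap (R : realType) (N : nat) (lambda : R) : R :=
  inf (gaps N lambda).

Lemma gap_le (R : realType) (N : nat) (lambda g : R) :
  gaps N lambda g -> gap N lambda <= g.
Proof.
move=> gE; apply: ge_inf => //; exists 0 => _ [a [b [_ ->]]].
exact: normr_ge0.
Qed.

Lemma gap_mem (R : realType) (N : nat) (lambda : R) :
  (0 < N)%N -> gaps N lambda (gap N lambda).
Proof.
move=> N0; pose T := {ffun 'I_N -> bool}.
pose p0 : T * T := ([ffun=> true], [ffun=> false]).
have p0P : p0.1 != p0.2.
  by apply/eqP => /ffunP /(_ (Ordinal N0)); rewrite !ffunE.
case: (@arg_minP _ R _ p0 (fun p : T * T => p.1 != p.2)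
  (fun p : T * T => `|digit_diff p.1 p.2 lambda|) p0P) => -[a b] /= ab hmin.
suff -> : gap N lambda = `|digit_diff a b lambda| by exists a, b.
apply/eqP; rewrite eq_le gap_le /=; last by exists a, b.
apply: lb_le_inf; first by exists `|digit_diff a b lambda|, a, b.
by move=> _ [c [d [cd ->]]]; exact: (hmin (c, d)).
Qed.

(* Main.v *)
(** Let [lambda] lie in [[1/2, 0.668]] and let [g] be a polynomial with
    coefficients in {-1, 0, 1} and [g(0) = 1]. Such a [g] has no double zero,
    nor anything close to one: on each of finitely many cells covering the
    interval there are a natural number [m] and a sign [s] such that
    [s (m g - lambda g')] is bounded below by a fixed positive constant. As
    this quantity is [- s lambda^(m+1)] times the derivative of
    [g / lambda^m], that quotient is uniformly monotone on the cell, and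
    [|g| <= rho] confines [lambda] to an interval of length [O(rho)].

    The pairs [(m, s)] are found by a search over the prefixes of [g]. The
    linear form [sum a_k (m - k) lambda^k] is [m g - lambda g'], so a prefix of
    length [n] is settled once its contribution exceeds
    [sum_(k >= n) |m - k| lambda^k]. The smallest double zero of a power series
    with such coefficients is about 0.66848, so the search terminates, but only
    just.

    Splitting a nonzero word according to whether its first letter vanishes, and
    dividing by [lambda >= 1/2] if it does, shows by induction on [N] that
    [gap N <= rho] happens on a set of measure [O(3^N rho)]. As
    [3^N alpha_N] tends to 0, the set where [gap N <= alpha_N] for all large [N]
    is null; only this weak form of Borel-Cantelli is needed. *)

From Stdlib Require Import BinInt.
Require Import Defs.
From mathcomp Require Import all_boot all_order all_algebra.
From mathcomp Require Import all_classical all_reals all_analysis.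
From mathcomp Require Import ring lra zify ssrZ.
Import Order.TTheory GRing.Theory Num.Theory.
Import numFieldNormedType.Exports.

Set Implicit Arguments.
Unset Strict Implicit.
Unset Printing Implicit Defensive.

Delimit Scope Z_scope with ZB.
Local Open Scope classical_set_scope.
Local Open Scope ring_scope.

(** * The search for transversality certificates *)

(* If [L <= S <= U], the [i]-th pair encloses [S x ^ i] for every [x] in
   [[p / q, p' / q]]; see [powers_enclosure]. *)
Fixpoint powers (p p' q : Z) (n : nat) (L U : Z) : seq (Z * Z) :=
  (L, U) :: if n is n'.+1 then
    powers p p' q n' (L * p / q)%ZB (U * p' / q + 1)%ZB else [::].

(* The last entry stands for a whole geometric tail: for [0 <= x <= 0.668],
   [sum_i |w - i| x ^ i <= 4 |w| + 9] (see [wsum_norm_geometric]).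
   The value on the empty list is junk. *)
Fixpoint tail_bound (w : Z) (LU : seq (Z * Z)) : Z :=
  if LU is (_, U) :: r then
    if r is [::] then ((4 * Z.abs w + 9) * U)%ZB
    else (Z.abs w * U + tail_bound (w - 1) r)%ZB
  else 0%ZB.

(* Lower bound for [s * sum_k a_k (w - k) x ^ k] over all words starting with
   [P]. The value when [LU] is too short is junk. *)
Fixpoint lower_bound (s w : Z) (P : seq Z) (LU : seq (Z * Z)) : Z :=
  if P is a :: P' then
    if LU is (L, U) :: r then
      let c := (s * (a * w))%ZB in
      (c * (if Z.leb 0 c then L else U) + lower_bound s (w - 1) P' r)%ZB
    else 0%ZB
  else (- tail_bound w LU)%ZB.

Definition digits : seq Z := [:: -1; 0; 1]%ZB.

(* The form [m g - x g'] and its opposite suffice, with [m] a natural number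
   at least [size P]: positivity of [c g - c' x g'] minus the tail is piecewise
   linear in [(c, c')], with breakpoints at [c / c' = k] for [k >= size P].
   Five values of [m] turn out to be enough. *)
Definition leaf (LU : seq (Z * Z)) (P : seq Z) : bool :=
  (size P < size LU)%N &&
  has (fun m => has (fun s => Z.ltb 0 (lower_bound s (Z.of_nat m) P LU))
                    [:: 1; -1]%ZB)
      (iota (size P) 5).

(* [if] rather than [||], which would explore the whole tree under
   call-by-value. *)
Fixpoint search (LU : seq (Z * Z)) (n : nat) (P : seq Z) : bool :=
  if leaf LU P then true else
  if n is n'.+1 then all (fun a => search LU n' (rcons P a)) digits else false.

(** Powers of [x] are computed in fixed point, with [scale] as the unit. *)
Definition scale : Z := (2 ^ 40)%ZB.
Definition denom : Z := 10000%ZB.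

(** Prefixes have length at most 21, while powers are enclosed up to exponent 40, so the crude
    geometric estimate enters only from [x ^ 40] on. *)
Definition cell (p p' : Z) : bool :=
  search (powers p p' denom 40 scale scale) 20 [:: 1%ZB].

Fixpoint cells (p : Z) (r : seq Z) : bool :=
  if r is p' :: r' then cell p p' && cells p' r' else true.

(* Numerators over [denom], found by greedily extending each cell as far as
   the search succeeds. *)
Definition breakpoints : seq Z :=
  [:: 6491; 6549; 6613; 6624; 6637; 6654; 6663; 6667; 6672; 6675; 6677; 6678;
      6679; 6680]%ZB.

Lemma cells_breakpoints : cells 5000%ZB breakpoints.
Proof. by vm_compute. Qed.

(** * Soundness of the search *)

Section Soundness.
Variable R : realFieldType.
Implicit Types (x S : R) (d e P : seq Z) (LU : seq (Z * Z)).

(* Locked, because unification would otherwise turn [zr scale] into a unary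
   natural number. *)
Definition zr : Z -> R := locked (fun z => (int_of_Z z)%:~R).

Lemma zrE z : zr z = (int_of_Z z)%:~R. Proof. by rewrite /zr -lock. Qed.

Lemma zrD a b : zr (a + b)%ZB = zr a + zr b.
Proof. by rewrite !zrE -intrD -rmorphD. Qed.

Lemma zrM a b : zr (a * b)%ZB = zr a * zr b.
Proof. by rewrite !zrE -intrM -rmorphM. Qed.

Lemma zrN a : zr (- a)%ZB = - zr a.
Proof. by rewrite !zrE -mulrNz -rmorphN. Qed.

Lemma zr0 : zr 0%ZB = 0. Proof. by rewrite zrE. Qed.

Lemma zr1 : zr 1%ZB = 1. Proof. by rewrite zrE. Qed.

Lemma zrN1 : zr (-1)%ZB = -1. Proof. by rewrite zrE. Qed.

Lemma zrB1 a : zr (a - 1)%ZB = zr a - 1.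
Proof. by rewrite zrD zrN zr1. Qed.

Lemma zr_nat n : zr (Z.of_nat n) = n%:R.
Proof. by rewrite -[n%:R]/(n%:Z%:~R) zrE; congr _%:~R; lia. Qed.

Lemma ler_zr a b : (a <= b)%ZB -> zr a <= zr b.
Proof. by move=> ab; rewrite !zrE ler_int; lia. Qed.

Lemma zr_ge0 a : (0 <= a)%ZB -> 0 <= zr a.
Proof. by rewrite -zr0; exact: ler_zr. Qed.

Lemma zr_ge0P a : 0 <= zr a -> (0 <= a)%ZB.
Proof. by rewrite zrE ler0z; lia. Qed.

Lemma zr_gt0 a : (0 < a)%ZB -> 0 < zr a.
Proof. by rewrite zrE ltr0z; lia. Qed.

Lemma zr_abs a : zr (Z.abs a) = `|zr a|.
Proof.
case: (Z.abs_spec a) => -[h ->].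
  by rewrite ger0_norm// zr_ge0.
by rewrite zrN ler0_norm// -zr0 ler_zr//; lia.
Qed.



Definition digit (a : Z) : bool := a \in digits.

Lemma digitN a : digit a -> digit (- a)%ZB.
Proof. by rewrite /digit !inE => /or3P[]/eqP->. Qed.

Lemma digit_norm a : digit a -> `|zr a| <= 1.
Proof.
by rewrite /digit !inE => /or3P[]/eqP->; rewrite ?zrN1 ?zr1 ?zr0 ?normrN ?normr1 ?normr0.
Qed.

(* [S * \sum_i d_i (w - i) x ^ i] *)
Fixpoint wsum (w : Z) S d x : R :=
  if d is a :: d' then zr a * zr w * S + wsum (w - 1)%ZB (S * x) d' x else 0.

Fixpoint peval d x : R := if d is a :: d' then zr a + x * peval d' x else 0.

Fixpoint pderiv d x : R :=
  if d is a :: d' then peval d' x + x * pderiv d' x else 0.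

Lemma wsumE w S d x :
  wsum w S d x = S * (zr w * peval d x - x * pderiv d x).
Proof.
elim: d w S => [|a d IH] w S /=; first by rewrite !mulr0 subr0 mulr0.
by rewrite IH zrB1; ring.
Qed.

Lemma peval_rcons0 P x : peval (rcons P 0%ZB) x = peval P x.
Proof. by elim: P => [|a P /= ->]//=; rewrite zr0 mulr0 addr0. Qed.

Lemma pderiv_rcons0 P x : pderiv (rcons P 0%ZB) x = pderiv P x.
Proof.
by elim: P => [|a P /= ->]/=; rewrite ?peval_rcons0// mulr0 addr0.
Qed.

Fixpoint enclosure x S LU : Prop :=
  if LU is (L, U) :: r then
    [/\ 0 <= zr L, zr L <= S, S <= zr U & enclosure x (S * x) r]
  else True.

Lemma powers_enclosure p p' q n L U x S : 0 <= x -> (0 < q)%ZB -> (0 <= p)%ZB ->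
  zr p <= x * zr q -> x * zr q <= zr p' -> 0 <= zr L -> zr L <= S -> S <= zr U ->
  enclosure x S (powers p p' q n L U).
Proof.
move=> x0 q0 p0 px xp; elim: n L U S => [|n IH] L U S L0 LS SU /=; split => //.
have q0' : 0 < zr q by exact: zr_gt0.
have S0 : 0 <= S by exact: le_trans LS.
have p0' : 0 <= zr p by exact: zr_ge0.
have L0' : (0 <= L)%ZB by exact: zr_ge0P.
(* Integer division rounds down, which suits the lower end; the added 1 makes up for it at the upper
   end. *)
have h1 : zr (L * p / q)%ZB * zr q <= zr L * zr p.
  by rewrite -!zrM ler_zr// Z.mul_comm; apply: Z.mul_div_le.
have h2 : zr U * zr p' <= zr (U * p' / q + 1)%ZB * zr q.
  rewrite -!zrM ler_zr//; have := Z.mul_succ_div_gt (U * p')%ZB q q0; lia.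
apply: IH.
- by apply: zr_ge0; apply: Z.div_pos => //; apply: Z.mul_nonneg_nonneg.
- rewrite -(ler_pM2r q0'); apply: le_trans h1 _; rewrite -mulrA.
  exact: ler_pM.
- rewrite -(ler_pM2r q0'); apply: le_trans h2; rewrite -mulrA.
  by apply: ler_pM => //; rewrite mulr_ge0// ltW.
Qed.

(** The constants reproduce themselves under the recursion: [1 + 4 * 0.668 <= 4] and
    [(4 + 9) * 0.668 <= 9]. *)
Lemma wsum_norm_geometric w S d x : all digit d ->
  0 <= S -> 0 <= x <= 167 / 250 ->
  `|wsum w S d x| <= (4 * `|zr w| + 9) * S.
Proof.
move=> + S0 /andP[x0 x1]; elim: d w S S0 => [|a d IH] w S S0 /=.
  by rewrite normr0 mulr_ge0// addr_ge0// mulr_ge0.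
case/andP => /digit_norm a1 /IH{}IH; apply: le_trans (ler_normD _ _) _.
have Sx0 : 0 <= S * x by rewrite mulr_ge0.
have := IH (w - 1)%ZB _ Sx0; rewrite zrB1 => h.
have h1 : `|zr a * zr w * S| <= `|zr w| * S.
  by rewrite !normrM (ger0_norm S0) ler_wpM2r// ler_piMl.
have h2 : `|zr w - 1| <= `|zr w| + 1 by rewrite (le_trans (ler_normB _ _))// normr1.
have h3 : (4 * `|zr w - 1| + 9) * (S * x) <=
          (4 * (`|zr w| + 1) + 9) * (S * (167 / 250)).
  apply: ler_pM; rewrite ?addr_ge0 ?mulr_ge0//; last by rewrite ler_wpM2l.
  by rewrite lerD2r ler_wpM2l.
apply: le_trans (lerD h1 (le_trans h h3)) _.
have := mulr_ge0 (normr_ge0 (zr w)) S0; nra.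
Qed.

Lemma wsum_norm_tail w S d x LU : all digit d -> (0 < size LU)%N ->
  0 <= x <= 167 / 250 -> enclosure x S LU ->
  `|wsum w S d x| <= zr (tail_bound w LU).
Proof.
move=> + + xI; elim: LU w S d => // -[L U] LU IH w S d dd _.
move=> [L0 LS SU enc].
have S0 : 0 <= S by exact: le_trans LS.
have x0 : 0 <= x by case/andP: xI.
case: LU IH enc => [|LU0 LU] IH enc.
  apply: le_trans (wsum_norm_geometric _ _ _ _) _ => //.
  rewrite -[tail_bound _ _]/((4 * Z.abs w + 9) * U)%ZB zrM zrD zrM zr_abs.
  rewrite (zr_nat 4 : zr 4 = 4) (zr_nat 9 : zr 9 = 9).
  by apply: ler_pM => //; rewrite addr_ge0// mulr_ge0.
rewrite -[tail_bound _ _]/(Z.abs w * U + tail_bound (w - 1) (LU0 :: LU))%ZB.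
rewrite zrD zrM zr_abs; case: d dd => [_|a d /= /andP[/digit_norm a1 dd]].
  (* If the word ends before the list, the induction hypothesis for the empty word shows that the
     rest of the bound is nonnegative. *)
  have := IH (w - 1)%ZB _ [::] isT isT enc.
  rewrite -[wsum _ _ [::] _]/(0 : R) -[wsum _ _ [::] _]/(0 : R) normr0 => h.
  by rewrite addr_ge0 ?mulr_ge0// (le_trans S0).
apply: le_trans (ler_normD _ _) _; apply: lerD; last exact: IH.
rewrite normrM (ger0_norm S0); apply: ler_pM => //.
by rewrite normrM ler_piMl.
Qed.

Lemma lower_boundP s w P e x S LU : s \in [:: 1; -1]%ZB ->
  all digit e -> (size P < size LU)%N ->
  0 <= x <= 167 / 250 -> enclosure x S LU ->
  zr (lower_bound s w P LU) <= zr s * wsum w S (P ++ e) x.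
Proof.
move=> s1 de + xI; elim: P w S LU => [|a P IH] w S [|[L U] LU]//= szP.
  move=> enc; rewrite zrN.
  have : `|zr s * wsum w S e x| <= zr (tail_bound w ((L, U) :: LU)).
    rewrite normrM (_ : `|zr s| = 1) ?mul1r; last first.
      by move: s1; rewrite !inE => /orP[]/eqP->; rewrite ?zrN1 ?normrN ?zr1 normr1.
    exact: wsum_norm_tail.
  by rewrite ler_norml => /andP[].
move=> [L0 LS SU enc]; rewrite zrD mulrDr lerD//; last exact: IH.
rewrite !zrM !mulrA; case: Z.leb_spec => h.
  by apply: ler_wpM2l => //; rewrite -mulrA -!zrM zr_ge0.
by apply: ler_wnM2l => //; rewrite -mulrA -!zrM -zr0 ler_zr//; lia.
Qed.

(* The pair [(m, s)] may depend on the word [d], but not on the point [x]. *)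
Definition transversal (p p' : Z) d := exists m : nat, exists s : Z,
  [/\ (m <= 25)%N, s \in [:: 1; -1]%ZB &
  forall x, zr p <= x * zr denom -> x * zr denom <= zr p' ->
    1 <= zr scale * (zr s * (m%:R * peval d x - x * pderiv d x))].

Lemma searchP p p' n P e : (0 <= p)%ZB -> (p' * 250 <= 167 * denom)%ZB ->
  (size P + n <= 21)%N -> all digit e ->
  search (powers p p' denom 40 scale scale) n P -> transversal p p' (P ++ e).
Proof.
move=> p0 p1; set LU := powers _ _ _ _ _ _.
(* The bound [m <= 25] comes from [m < size Q + 5] and [size Q <= 21]. *)
have leafP Q f : (size Q <= 21)%N -> all digit f -> leaf LU Q -> transversal p p' (Q ++ f).
  move=> szQ df /andP[szLU /hasP[m]]; rewrite mem_iota => /andP[_ mQ].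
  case/hasP => s s1 /Z.ltb_spec0 low; exists m, s; split => //; first by lia.
  move=> x px xp'.
  have q0 : 0 < zr denom by exact: zr_gt0.
  have x0 : 0 <= x.
    by rewrite -(pmulr_lge0 _ q0); apply: le_trans px; exact: zr_ge0.
  have : x * zr denom * zr 250 <= zr 167 * zr denom.
    apply: le_trans (ler_wpM2r (zr_ge0 _) xp') _; first by [].
    by rewrite -!zrM; exact: ler_zr.
  rewrite [X in X <= _]mulrAC.
  rewrite (ler_pM2r q0).
  have -> : zr 250 = 250 by exact: (zr_nat 250).
  have -> : zr 167 = 167 by exact: (zr_nat 167).
  move=> x1; have {}x1 : x <= 167 / 250 by lra.
  have enc : enclosure x (zr scale) LU.
    exact: (powers_enclosure 40 x0 _ p0 px xp' (zr_ge0 _) (lexx _) (lexx _)).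
  have h := @lower_boundP s (Z.of_nat m) Q f x (zr scale) LU s1 df szLU.
  rewrite mulrCA -(zr_nat m) -wsumE; apply: le_trans (h _ enc); last by rewrite x0.
  (* A positive integer is at least 1; this makes the bound uniform. *)
  by rewrite -zr1 ler_zr//; lia.
elim: n P e => [|n IH] P e szP de.
  rewrite /search; case: ifP => // lf _; apply: leafP => //; lia.
rewrite [search _ _ _]/=; case: ifP => [lf _|_]; first by apply: leafP => //; lia.
case/and4P => s0 s1 s2 _; case: e de => [_|a e /= /andP[da de]].
  (* A word that ends at an unsettled prefix is padded with a zero, which changes neither its value
     nor its derivative. *)
  have := IH (rcons P 0%ZB) [::] _ isT s1; rewrite size_rcons => /(_ _)[|m [s]]; first by lia.
  rewrite cats0 => -[m1 ss h]; exists m, s; rewrite cats0; split => // x px xp.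
  by have := h x px xp; rewrite peval_rcons0 pderiv_rcons0.
rewrite -cat_rcons; apply: IH => //; first by rewrite size_rcons; lia.
by move: da; rewrite /digit !inE => /or3P[]/eqP->.
Qed.

End Soundness.

(** * Bounds on outer measure *)

Section Coverable.
Variable R : realType.
Local Notation mu := (@lebesgue_measure R).

(** Bounds the outer measure of [B], so that [B] itself need not be shown measurable. *)
Definition coverable (B : set R) (r : R) :=
  exists A, [/\ measurable A, B `<=` A & (mu A <= r%:E)%E].

Lemma coverableS B B' r r' : B `<=` B' -> r' <= r ->
  coverable B' r' -> coverable B r.
Proof.
move=> BB rr [A [mA BA muA]]; exists A; split => //.
  exact: subset_trans BA.
by apply: le_trans muA _; rewrite lee_fin.
Qed.

Lemma coverableU B B' r r' : coverable B r -> coverable B' r' ->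
  coverable (B `|` B') (r + r').
Proof.
move=> [A [mA BA muA]] [A' [mA' BA' muA']]; exists (A `|` A'); split.
- exact: measurableU.
- exact: setUSS.
- by apply: le_trans (measureU2 mu mA mA') _; rewrite EFinD leeD.
Qed.

Lemma coverable0 : coverable set0 0.
Proof. by exists set0; split => //; rewrite measure0. Qed.

Lemma coverable_seq (T : eqType) (s : seq T) (B : T -> set R) r :
  (forall t, t \in s -> coverable (B t) r) ->
  coverable [set x | exists2 t, t \in s & B t x] ((size s)%:R * r).
Proof.
elim: s => [_|t s IH h].
  by apply: coverableS coverable0; rewrite ?mul0r// => x [].
have ht : coverable (B t) r by apply: h; rewrite inE eqxx.
have hs : coverable [set x | exists2 t, t \in s & B t x] ((size s)%:R * r).
  by apply: IH => u us; apply: h; rewrite inE us orbT.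
apply: coverableS (coverableU ht hs); last by rewrite /= -add1n natrD mulrDl mul1r.
by move=> x [u]; rewrite inE => /orP[/eqP->|us]; [left|right; exists u].
Qed.

Lemma coverable_diam (B : set R) r : 0 <= r ->
  (forall x y, B x -> B y -> x < y -> y - x <= r) -> coverable B (2 * r).
Proof.
move=> r0 diam; have [->|/set0P[a Ba]] := eqVneq B set0.
  by apply: coverableS coverable0; rewrite ?mulr_ge0.
(* Centring the interval at a point of [B] costs the factor 2 but avoids the infimum of [B]. *)
exists [set` `[a - r, a + r]]; split => //.
- move=> x Bx; rewrite /= in_itv /=; apply/andP.
  case: (ltgtP a x) => [ax|xa|<-]; last by split; lra.
    by have := diam _ _ Ba Bx ax; split; lra.
  by have := diam _ _ Bx Ba xa; split; lra.
- rewrite lebesgue_measure_itv /=; case: ifP => _; last by rewrite lee_fin mulr_ge0.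
  by rewrite -EFinB lee_fin; lra.
Qed.

End Coverable.

(** * Measure of the set where a word is small *)

Section Peval.
Variable R : realType.
Implicit Types (x : R) (d : seq Z).

Lemma is_derive_peval d x : is_derive x 1 (peval d) (pderiv d x).
Proof.
elim: d => [|a d IH] /=; first exact: is_derive_cst.
have -> : peval d x + x * pderiv d x =
    0 + (x *: pderiv d x + peval d x *: (1 : R)).
  by rewrite add0r addrC /GRing.scale /= mulr1.
exact: is_deriveD (is_derive_cst _ _ _) (is_deriveM (is_derive_id _ _) IH).
Qed.

Lemma is_derive_ratio d m x : 0 < x ->
  is_derive x 1 (fun t : R => peval d t * (t ^+ m)^-1)
    (- (m%:R * peval d x - x * pderiv d x) / x ^+ m.+1).
Proof.
move=> x0; have xm0 : x ^+ m != 0 by rewrite expf_neq0// gt_eqF.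
have h1 : is_derive x (1 : R) (fun t : R => t ^+ m) (m%:R * x ^+ m.-1).
  have := @is_deriveX R R id m x 1 1 (is_derive_id _ _).
  rewrite /GRing.scale /= mulr1 (_ : id ^+ m = (fun t : R => t ^+ m))//.
  by apply/funext => t; rewrite exprfctE.
have h2 := is_deriveM (is_derive_peval d x) (@is_deriveV R (fun t => t ^+ m) x _ 1 xm0 h1).
suff e : - (m%:R * peval d x - x * pderiv d x) / x ^+ m.+1 =
   peval d x *: (- (x ^+ m) ^- 2 *: (m%:R * x ^+ m.-1)) +
   (x ^+ m)^-1 *: pderiv d x by rewrite e; exact: h2.
rewrite /GRing.scale /=; case: m xm0 {h1 h2} => [|m] xm0 /=.
  by rewrite expr0 expr1; field; rewrite gt_eqF.
by rewrite !exprS; field; rewrite expf_neq0 gt_eqF.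
Qed.

Lemma ratio_increment d m (k x y : R) (s : Z) : 1 / 2 <= x -> x < y -> y <= 1 ->
  s \in [:: 1; -1]%ZB ->
  (forall t, x <= t <= y -> k <= zr R s * (m%:R * peval d t - t * pderiv d t)) ->
  k * (y - x) <= `|peval d y * (y ^+ m)^-1 - peval d x * (x ^+ m)^-1|.
Proof.
move=> x0 xy y1 s1 h.
have pos t : x <= t -> 0 < t by lra.
have [] := @MVT R (fun t : R => peval d t * (t ^+ m)^-1)
    (fun t => - (m%:R * peval d t - t * pderiv d t) / t ^+ m.+1) x y xy.
- by move=> t; rewrite in_itv /= => /andP[xt ty]; apply: is_derive_ratio; lra.
- apply: derivable_within_continuous => t; rewrite in_itv /= => /andP[xt ty].
  by have [] := @is_derive_ratio d m t (pos _ xt).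
move=> c; rewrite in_itv /= => /andP[xc cy] ->.
rewrite normrM (gtr0_norm (_ : 0 < y - x)) ?subr_gt0//.
rewrite ler_wpM2r ?subr_ge0 ?(ltW xy)// normrM normrN.
have c0 : 0 < c by lra.
have /h hc : x <= c <= y by rewrite !ltW.
set v := _ - _ in hc *.
have hv : k <= `|v|.
  move: s1 hc; rewrite !inE => /orP[]/eqP->.
    by rewrite zr1 mul1r => /le_trans -> //; exact: ler_norm.
  by rewrite zrN1 mulN1r -normrN => /le_trans -> //; exact: ler_norm.
(* As [c <= 1], dividing by [c ^+ m.+1] can only increase the absolute value. *)
apply: le_trans hv _; rewrite ler_peMr// ger0_norm ?invr_ge0 ?exprn_ge0 ?(ltW c0)//.
rewrite -[1]invr1 lef_pV2 ?posrE ?exprn_gt0// exprn_ile1 ?(ltW c0)//; lra.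
Qed.


Lemma zr_scale_gt0 : 0 < zr R scale.
Proof. exact: zr_gt0. Qed.

Lemma denom_bounds (p p' : Z) x : (5000 <= p)%ZB -> (p' * 250 <= 167 * denom)%ZB ->
  zr R p <= x * zr R denom <= zr R p' -> 1 / 2 <= x <= 1.
Proof.
move=> p0 p1 /andP[px xp]; have q0 : 0 < zr R denom by exact: zr_gt0.
have q2 : zr R denom = 2 * zr R 5000 by rewrite -(zr_nat R 2) -zrM.
have h1 := le_trans (ler_zr R p0) px.
have h2 : x * zr R denom <= zr R denom.
  by apply: le_trans xp (ler_zr R _); rewrite /denom in p1 *; lia.
apply/andP; split; last by rewrite -(ler_pM2r q0) mul1r.
rewrite -(ler_pM2r q0) {1}q2; lra.
Qed.

(** Since [x >= 1/2] and [m <= 25], two values of [g / x ^ m] differ by at most [2 ^ 26 rho], while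
    the slope is at least [1 / scale] in absolute value. The last factor 2 is that of
    [coverable_diam]. *)
Lemma coverable_transversal (p p' : Z) d (rho : R) : 0 <= rho ->
  (5000 <= p)%ZB -> (p' * 250 <= 167 * denom)%ZB -> transversal R p p' d ->
  coverable [set x : R | zr R p <= x * zr R denom <= zr R p' /\
     `|peval d x| <= rho] (2 ^+ 27 * zr R scale * rho).
Proof.
move=> rho0 p0 p1 [m [s [m25 s1 h]]]; have sc0 := zr_scale_gt0.
have -> : 2 ^+ 27 * zr R scale * rho = 2 * (2 ^+ 26 * zr R scale * rho).
  by rewrite (exprS _ 26) !mulrA.
apply: coverable_diam => [|x y [xI hx] [yI hy] xy].
  by rewrite !mulr_ge0// ltW.
have /andP[x0 x1] := denom_bounds p0 p1 xI.
have /andP[y0 y1] := denom_bounds p0 p1 yI.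
have q0 : 0 < zr R denom by exact: zr_gt0.
have hk t : x <= t <= y ->
    (zr R scale)^-1 <= zr R s * (m%:R * peval d t - t * pderiv d t).
  move=> /andP[xt ty]; rewrite -(ler_pM2l sc0) divff ?gt_eqF//; apply: h.
    by case/andP: xI => + _ => /le_trans -> //; rewrite ler_pM2r.
  by case/andP: yI => _; apply: le_trans; rewrite ler_pM2r.
have := ratio_increment x0 xy y1 s1 hk.
rewrite mulrC ler_pdivrMr// => /le_trans; apply.
rewrite mulrAC ler_pM2r//.
have bound t : 1 / 2 <= t -> `|peval d t| <= rho ->
    `|peval d t * (t ^+ m)^-1| <= rho * 2 ^+ 25.
  move=> t0 ht; rewrite normrM; apply: ler_pM => //.
  rewrite ger0_norm ?invr_ge0 ?exprn_ge0//; last by lra.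
  have tm : (1 / 2) ^+ m <= t ^+ m by rewrite lerXn2r ?nnegrE//; lra.
  apply: (@le_trans _ _ (2 ^+ m)); last by rewrite ler_weXn2l// ler1n.
  rewrite (_ : 2 ^+ m = ((1 / 2) ^+ m)^-1); last by rewrite div1r exprVn invrK.
  by rewrite lef_pV2// posrE exprn_gt0//; lra.
apply: le_trans (ler_normB _ _) _.
apply: le_trans (lerD (bound _ y0 hy) (bound _ x0 hx)) _.
rewrite (exprS _ 25); lra.
Qed.

Lemma cells_coverable (p : Z) (r : seq Z) e (rho : R) : 0 <= rho -> all digit e ->
  (5000 <= p)%ZB -> all (fun p' => Z.leb 5000 p' && Z.leb (p' * 250) (167 * denom)) r ->
  cells p r ->
  coverable [set x : R | zr R p <= x * zr R denom <= zr R (last p r) /\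
     `|peval (1%ZB :: e) x| <= rho] ((size r)%:R * (2 ^+ 27 * zr R scale * rho)).
Proof.
move=> rho0 de; elim: r p => [|p' r IH] p p0 /=.
  (* With no cell left, the interval is a single point. *)
  move=> _ _; rewrite mul0r -(mulr0 2); apply: coverable_diam => // x y.
  move=> [/andP[px xp] _] [/andP[py yp] _] xy.
  have q0 : 0 < zr R denom by exact: zr_gt0.
  by have : y <= x; [rewrite -(ler_pM2r q0); exact: le_trans px|rewrite leNgt xy].
move=> /andP[/andP[/Z.leb_spec0 p0' /Z.leb_spec0 p1'] hr] /andP[hc hcs].
have ht : transversal R p p' (1%ZB :: e).
  apply: (@searchP R p p' 20 [:: 1%ZB] e) => //; lia.
have h := coverableU (coverable_transversal rho0 p0 p1' ht) (IH p' p0' hr hcs).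
apply: coverableS h; last first.
  by rewrite -[(size r).+1%:R]/((1 + size r)%:R) natrD mulrDl mul1r.
move=> x [/andP[px xp] hx].
by case: (leP (x * zr R denom) (zr R p')) => hp; [left|right]; split => //;
  rewrite ?px ?xp ?hp ?(ltW hp).
Qed.

Definition cover_const : R := (size breakpoints)%:R * (2 ^+ 27 * zr R scale).

Lemma coverable_monic e (rho : R) : 0 <= rho -> all digit e ->
  coverable [set x : R | 1 / 2 <= x <= 668 / 1000 /\ `|peval (1%ZB :: e) x| <= rho]
    (cover_const * rho).
Proof.
move=> rho0 de.
have := @cells_coverable 5000 breakpoints e rho rho0 de (Z.le_refl _) isT
  cells_breakpoints.
rewrite mulrA; apply: coverableS => // x [/andP[x0 x1] hx]; split => //.
have q0 : 0 < zr R denom by exact: zr_gt0.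
have -> : zr R (last 5000%ZB breakpoints) = 668 / 1000 * zr R denom.
  have : zr R (last 5000%ZB breakpoints) * zr R 250 = zr R 167 * zr R denom.
    by rewrite -!zrM.
  rewrite (zr_nat R 250 : zr R 250 = 250) (zr_nat R 167 : zr R 167 = 167); lra.
have -> : zr R 5000%ZB = 1 / 2 * zr R denom.
  have -> : zr R denom = 2 * zr R 5000 by rewrite -(zr_nat R 2) -zrM.
  by rewrite mul1r mulrA mulVf ?mul1r.
by rewrite !ler_pM2r// x0.
Qed.

Fixpoint words (N : nat) : seq (seq Z) :=
  if N is N'.+1 then [seq a :: d | a <- digits, d <- words N'] else [:: [::]].

Lemma size_words N : size (words N) = (3 ^ N)%N.
Proof. by elim: N => //= N IH; rewrite !size_cat !size_map IH expnS /=; lia. Qed.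

Lemma words_digit N d : (d \in words N) = (size d == N) && all digit d.
Proof.
elim: N d => [|N IH] d; first by case: d.
rewrite -[words _]/[seq a :: d | a <- digits, d <- words N].
apply/allpairsP/andP => [[[b c] /= [bd cw ->]]|].
  by move: cw; rewrite IH /= eqSS /digit bd => /andP[-> ->].
case: d => [[]//|a d /= [sd /andP[da dd]]].
by exists (a, d); split => //=; rewrite IH -eqSS sd.
Qed.

Lemma peval_opp d x : peval (map Z.opp d) x = - peval d x.
Proof. by elim: d => [|a d /= ->]/=; rewrite ?oppr0// zrN opprD mulrN. Qed.

(** In the inductive step, first letters 1 and -1 together cost [3 ^ N] covers, as negation
    exchanges them; the first letter 0 costs twice the bound for [N], as division by [x >= 1/2]
    doubles [rho]. The factor 3 is [1 + 2]. *)
Lemma coverable_words N (rho : R) : 0 <= rho ->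
  coverable [set x : R | 1 / 2 <= x <= 668 / 1000 /\
    exists d, [/\ d \in words N, has (predC1 0%ZB) d & `|peval d x| <= rho]]
    (cover_const * 3 ^+ N * rho).
Proof.
have c0 : 0 <= cover_const by rewrite !mulr_ge0// ltW// zr_scale_gt0.
elim: N rho => [|N IH] rho rho0.
  apply: coverableS (coverable0 R); first by move=> x [_ [d [/=]]]; rewrite inE => /eqP->.
  by rewrite expr0 mulr1 mulr_ge0.
have h2 : 0 <= 2 * rho by rewrite mulr_ge0.
pose B d := [set x : R | 1 / 2 <= x <= 668 / 1000 /\ `|peval (1%ZB :: d) x| <= rho].
have hB : coverable [set x | exists2 d, d \in words N & B d x]
    ((size (words N))%:R * (cover_const * rho)).
  apply: coverable_seq => d; rewrite words_digit => /andP[_ dd].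
  exact: coverable_monic.
apply: coverableS (coverableU hB (IH _ h2)); last first.
  by rewrite size_words natrX exprS; lra.
move=> x [xI [[|a d] [dw nz hx]]]; first by [].
move: dw; rewrite words_digit /= eqSS => /and3P[sd da dd].
have dN : map Z.opp d \in words N.
  by rewrite words_digit size_map sd all_map; apply: sub_all dd => b; exact: digitN.
have dw : d \in words N by rewrite words_digit sd.
move: da; rewrite /digit !inE => /or3P[]/eqP a1; rewrite a1 in hx nz.
- left; exists (map Z.opp d) => //; split => //=.
  rewrite peval_opp mulrN zr1 -normrN opprB addrC.
  by move: hx; rewrite /= zrN1.
- right; split => //; exists d; split => //.
  move: hx; rewrite /= zr0 add0r normrM => hx.
  case/andP: xI => x0 _; have : 1 / 2 * `|peval d x| <= rho.
    by apply: le_trans hx; rewrite ler_wpM2r// ger0_norm//; lra.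
  lra.
- by left; exists d.
Qed.

End Peval.

(** * Small gaps and null sets *)

Section Gap.
Variable R : realType.
Local Notation mu := (@lebesgue_measure R).

Lemma peval_enum N (F : 'I_N -> Z) (x : R) :
  peval (map F (enum 'I_N)) x = \sum_(i < N) zr R (F i) * x ^+ i.
Proof.
elim: N F => [|N IH] F; first by rewrite big_ord0 (size0nil (size_enum_ord 0)).
rewrite enum_ordSl /= -map_comp IH big_ord_recl expr0 mulr1 mulr_sumr.
by congr (_ + _); apply: eq_bigr => i _; rewrite /= exprS mulrCA.
Qed.

Lemma coverable_gap N (rho : R) : (0 < N)%N -> 0 <= rho ->
  coverable [set x : R | 1 / 2 <= x <= 668 / 1000 /\ gap N x <= rho]
    (cover_const R * 3 ^+ N * rho).
Proof.
move=> N0 rho0; apply: coverableS (lexx _) (coverable_words N rho0).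
move=> x [xI hx]; split => //.
have [a [b [ab gE]]] := gap_mem x N0.
pose F i := (Z.b2z (a i) - Z.b2z (b i))%ZB.
exists (map F (enum 'I_N)); split.
- rewrite words_digit size_map size_enum_ord eqxx all_map /=.
  by apply/allP => i _; rewrite /= /F; case: (a i); case: (b i).
- have [i abi] : exists i, a i != b i.
    apply/existsP; apply: contraNT ab => /existsPn h.
    by apply/eqP/ffunP => i; apply/eqP; rewrite -[_ == _]negbK h.
  rewrite has_map; apply/hasP; exists i; first by rewrite mem_enum.
  by move: abi; rewrite /= /F; case: (a i); case: (b i).
- rewrite peval_enum; move: hx; rewrite gE; congr (`|_| <= _).
  apply: eq_bigr => i _; congr (_ * _); rewrite /F.
  by case: (a i); case: (b i); rewrite ?zr0 ?zr1 ?zrN1 ?subrr ?subr0 ?sub0r.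
Qed.

(** Intersect covers of measure at most [1 / (n + 1)]. *)
Lemma negligible_coverable (B : set R) :
  (forall e : R, 0 < e -> coverable B e) -> mu.-negligible B.
Proof.
move=> h; have {h}/choice[A hA] n : exists A, [/\ measurable A, B `<=` A &
    (mu A <= (n.+1%:R^-1)%:E)%E] by apply: h; rewrite invr_gt0.
have mA n : measurable (A n) by have [] := hA n.
exists (\bigcap_n A n); split.
- exact: bigcapT_measurable.
- apply/eqP; rewrite eq_le measure_ge0 andbT; apply/lee_addgt0Pr => e e0.
  rewrite add0e; have [n] := ltr_add_invr e0; rewrite add0r => ne.
  have [_ _ h] := hA n.
  apply: le_trans (le_trans h _); last by rewrite lee_fin ltW.
  apply: le_measure.
  + by rewrite inE; exact: bigcapT_measurable.
  + by rewrite inE; exact: mA.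
  + by move=> x /(_ n Logic.I).
- by move=> x Bx n _; have [_ + _] := hA n; exact.
Qed.

Lemma nneseries_small_term (u : nat -> R) m e :
  (forall n, (m <= n)%N -> 0 <= u n) -> (\sum_(m <= n <oo) (u n)%:E < +oo)%E ->
  0 < e -> forall M, exists2 n, (maxn m M <= n)%N & u n < e.
Proof.
move=> u0 usum e0 M; apply/not_exists2P => h.
set K := maxn m M.
have big n : (K <= n)%N -> e <= u n.
  by move=> Kn; have [//|/negP] := h n; rewrite -leNgt.
have mK : (m <= K)%N by rewrite leq_maxl.
have s0 : (0 <= \sum_(m <= n <oo) (u n)%:E)%E.
  by apply: nneseries_ge0 => n mn _; rewrite lee_fin u0.
have sfin : (\sum_(m <= n <oo) (u n)%:E)%E \is a fin_num by rewrite ge0_fin_numE.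
set s := fine (\sum_(m <= n <oo) (u n)%:E)%E.
(* More than [s / e] terms, each at least [e], would exceed the sum [s]. *)
pose k := (Num.truncn (s / e)).+1.
have : (k%:R * e <= s).
  rewrite -lee_fin fineK//.
  apply: le_trans (@nneseries_lim_ge R (fun n => (u n)%:E) xpredT m (K + k) _); last first.
    by move=> n mn _; rewrite lee_fin u0.
  rewrite sumEFin lee_fin (big_cat_nat (n := K)) ?leq_addr//=.
  rewrite -[leLHS]add0r lerD//.
    by rewrite big_nat_cond sumr_ge0// => n; rewrite andbT => /andP[mn _]; exact: u0.
  rewrite -{1}(addKn K k) mulr_natl -sumr_const_nat.
  by apply: ler_sum_nat => n /andP[Kn _]; exact: big.
rewrite leNgt -ltr_pdivrMr//; apply/negP; rewrite negbK.
exact: truncnS_gt.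
Qed.

End Gap.

Theorem theorem2p4 (R : realType) (alpha : nat -> R)
  (alpha_gt0 : forall N : nat, (1 <= N)%N -> 0 < alpha N)
  (alpha_sum : (\sum_(1 <= N <oo) (3 ^+ N * alpha N)%:E < +oo)%E) :
  {ae @lebesgue_measure R, forall lambda : R,
     lambda \in `[1 / 2, 668 / 1000] ->
     infinite_set [set N : nat | (1 <= N)%N /\ alpha N < gap N lambda]}.
Proof.
pose E (M : nat) := [set x : R | 1 / 2 <= x <= 668 / 1000 /\
  forall N, (1 <= N)%N -> (M <= N)%N -> gap N x <= alpha N].
have EN M : (@lebesgue_measure R).-negligible (E M).
  apply: negligible_coverable => e e0.
  have c0 : 0 < cover_const R.
    by rewrite mulr_gt0// mulr_gt0// zr_scale_gt0.
  (* [E M] lies in the small-gap set of every single [N >= M], so one [N] with [3 ^ N alpha_N] small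
     enough suffices. *)
  have [N /[!geq_max]/andP[N1 MN] hN] := @nneseries_small_term R _ _ (e / cover_const R)
    (fun N N1 => mulr_ge0 (exprn_ge0 N (ler0n R 3)) (ltW (alpha_gt0 N N1)))
    alpha_sum (divr_gt0 e0 c0) M.
  apply: coverableS (coverable_gap N1 (ltW (alpha_gt0 N N1))).
    by move=> x [xI h]; split => //; exact: h.
  by rewrite -mulrA mulrC -ler_pdivlMr// ltW.
apply: negligibleS (negligible_bigcup EN) => x /= /not_implyP[xI].
rewrite in_itv /= in xI => /contrapT fin.
have [M hM] : exists M, forall N, (1 <= N)%N /\ alpha N < gap N x -> (N < M)%N.
  have [s sE] := (finite_seqP _).1 fin.
  exists (\max_(N <- s) N).+1 => N hN; rewrite ltnS.
  apply: (@leq_bigmax_seq _ s xpredT id) => //.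
  by have : [set` s] N by rewrite -sE.
exists M => //; split => // N N1 MN; rewrite leNgt; apply/negP => hN.
by have := hM N (conj N1 hN); rewrite ltnNge MN.
Qed.
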